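(* Let $X$ be a metric space. Then there exists an exceedingly rich family $\mathcal{S}$ of closed subsets of $X$ such that each $F\in\mathcal{S}$ is an almost isometric local retract in $X$.
   Context: For a topological space $Z$, $\operatorname{dens}Z$ is the least cardinality of a dense subset, and $\omega$ is the first infinite cardinal. A nonempty family $\mathcal{A}$ of sets is up-directed if for all $A,B\in\mathcal{A}$ there is $C\in\mathcal{A}$ with $A\cup B\subset C$. A family $\mathcal{S}$ of closed subsets of a topological space $Z$ is exceedingly rich if: (R-a) for every $Y\subset Z$ there is $S\in\mathcal{S}$ with $Y\subset S$ and $\max\{\operatorname{dens}Y,\omega\}=\max\{\operatorname{dens}S,\omega\}$; (R-b) if $\mathcal{A}\subset\mathcal{S}$ is up-directed, then $\overline{\bigcup\mathcal{A}}\in\mathcal{S}$. A subset $Y$ of a metric space $(X,d)$ is an almost isometric local retract in $X$ if for every finite set $E\subset X$ and every $\varepsilon>0$ there is a map $T:E\to Y$ such that $Tx=x$ for $x\in E\cap Y$ and $(1+\varepsilon)^{-1}d(x,y)\le d(Tx,Ty)\le(1+\varepsilon)d(x,y)$ for all $x,y\in E$. *)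

(* Defs.v *)
From HB Require Import structures.
From mathcomp Require Import all_boot all_order all_algebra.
From mathcomp Require Import all_classical all_reals all_analysis.
Set Implicit Arguments.
Unset Strict Implicit.
Unset Printing Implicit Defensive.
Import Order.TTheory GRing.Theory Num.Theory.
Local Open Scope classical_set_scope.
Local Open Scope ring_scope.
Local Open Scope card_scope.

(* Cardinals are represented by sets compared with [#<=] and [#=]: [dens Z] is
   a dense set of least cardinality, so only its cardinality is meaningful.
   Such a set always exists ([dens_spec]), hence the default is never used. *)
Definition dens (Z : topologicalType) : set Z :=
  xget setT [set D | dense D /\ forall E : set Z, dense E -> D #<= E].
Arguments dens Z : clear implicits.

(* A set whose cardinality is the larger of those of A and B; it lives in the
   sum type because A and B may be sets in different types. *)
Definition card_max (T U : Type) (A : set T) (B : set U) : set (T + U) :=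
  if A #<= B then inr @` B else inl @` A.

Definition up_directed (T : Type) (A : set (set T)) : Prop :=
  A !=set0 /\
  forall B C, A B -> A C -> exists2 D, A D & B `|` C `<=` D.

(* [dens (set_type Y)] is the density of Y with the topology induced by Z. *)
Definition exceedingly_rich (Z : topologicalType) (S : set (set Z)) : Prop :=
  [/\ forall F, S F -> closed F,
      forall Y : set Z, exists F, [/\ S F, Y `<=` F &
        card_max (dens (set_type Y)) [set: nat] #=
        card_max (dens (set_type F)) [set: nat]]
    & forall A : set (set Z), A `<=` S -> up_directed A ->
        S (closure (\bigcup_(F in A) F))].

(* A map E -> Y is given by a total map T of X with T(E) included in Y; its
   values outside E are irrelevant. *)
Definition almost_isometric_local_retract (R : realType) (X : metricType R)
    (Y : set X) : Prop :=
  forall (E : set X) (eps : R), finite_set E -> 0 < eps ->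
    exists T : X -> X,
      [/\ set_fun E Y T,
          forall x, (E `&` Y) x -> T x = x
        & forall x y, E x -> E y ->
            (1 + eps)^-1 * mdist x y <= mdist (T x) (T y)
              <= (1 + eps) * mdist x y].

(* Cardinals are well-founded: a maximal set Phi of choice functions of F on
   which all evaluations are injective is exhausted by some evaluation. *)
Lemma card_le_min (T : Type) (F : set (set T)) : F !=set0 ->
  exists2 D, F D & forall E, F E -> D #<= E.
Proof.
move=> [D0 FD0].
pose G (Phi : set (set T -> T)) :=
  (forall f, Phi f -> forall D, F D -> D (f D)) /\
  (forall D, F D -> forall f g, Phi f -> Phi g -> f D = g D -> f = g).
have [|Phi [[Phi1 Phi2] Phimax]] := @Zorn_bigcup _ G.
  move=> H HG totH; split=> [f [Q HQ Qf]|D FD f g [Q HQ Qf] [Q' HQ' Qg]].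
    exact: (HG _ HQ).1.
  have [QQ'|Q'Q] := totH _ _ HQ HQ'.
    by apply: (HG _ HQ').2 => //; exact: QQ'.
  by apply: (HG _ HQ).2 => //; exact: Q'Q.
have [D [FD surjD]] : exists D, F D /\
    forall t, D t -> exists2 f, Phi f & f D = t.
  apply: contrapT => noD.
  have /choice[t tP] : forall D, exists t, F D ->
      D t /\ forall f, Phi f -> f D <> t.
    move=> D; have [FD|nFD] := pselect (F D); last first.
      have [[t _]|D00] := pselect (D0 !=set0); first by exists t.
      by exfalso; apply: noD; exists D0; split=> // t D0t; case: D00; exists t.
    apply: contrapT => nt; apply: noD; exists D; split=> // t Dt.
    apply: contrapT => nf; apply: nt; exists t => _; split=> // f Phif fDt.
    by apply: nf; exists f.
  apply: (Phimax (Phi `|` [set t])).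
    split; first by move=> f; left.
    by move=> /(_ t (or_intror erefl)) /= /((tP _ FD0).2 t); apply.
  split=> [f [/Phi1//|->] D /tP[]//|D FD f g].
  have [_ tD] := tP _ FD.
  move=> [Pf|->] [Pg|->] // fg; first exact: Phi2 fg.
    by case: (tD _ Pf).
  by case: (tD _ Pg).
exists D => // E FE.
have DPhi : D #<= Phi.
  apply: (card_le_trans _ (card_image_le (fun f => f D) Phi)).
  by apply: subset_card_le => t /surjD[f Pf <-]; exists f.
apply: (card_le_trans DPhi).
have : (fun f => f E) @` Phi #= Phi.
  by apply: inj_card_eq => f g /set_mem Pf /set_mem Pg; exact: Phi2.
rewrite card_eq_le => /andP[_ /card_le_trans]; apply.
by apply: subset_card_le => _ [f /Phi1 + <-]; exact.
Qed.

Lemma dens_spec (Z : topologicalType) :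
  dense (dens Z) /\ forall E : set Z, dense E -> dens Z #<= E.
Proof.
have [|D dD Dmin] := @card_le_min Z [set D | dense D].
  by exists setT => O [x Ox] _; exists x.
rewrite /dens; case: xgetP => [E _ []//|/(_ D) nD]; by case: nD.
Qed.

(* Main.v *)
(* The closed almost isometric local retracts themselves form an exceedingly
   rich family.  Being an almost isometric local retract can be tested with an
   additive error on the distances, because finite sets have bounded distances
   and positive distances bounded away from 0.  In this form it passes to the
   closure of an up-directed union: finitely many points of the closure are
   moved slightly into a single member.  For (R-a) a dense subset of Y is closed
   off under countably many finitary operations, which adds at most
   max(dens Y, omega) points; this rests on kappa * kappa = kappa for infinite
   cardinals. *)
Require Import Defs.
From HB Require Import structures.
From mathcomp Require Import all_boot all_order all_algebra.
From mathcomp Require Import all_classical all_reals all_analysis.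
From mathcomp Require Import ring lra.
Set Implicit Arguments.
Unset Strict Implicit.
Unset Printing Implicit Defensive.
Import Order.TTheory GRing.Theory Num.Theory.

Local Open Scope classical_set_scope.

Local Open Scope card_scope.

(** * Cardinal comparison and squares of infinite cardinals *)

Lemma card_leI (T U : Type) (A : set T) (B : set U) (f : T -> U) :
  (forall x, A x -> B (f x)) ->
  (forall x y, A x -> A y -> f x = f y -> x = y) -> A #<= B.
Proof.
move=> fAB finj; have [|g] := (@injfunPex _ _ A B).2; last exact: inj_card_le g.
by exists f => // x y /set_mem Ax /set_mem Ay; exact: finj.
Qed.

Lemma card_leE (T U : Type) (A : set T) (B : set U) : A #<= B -> B !=set0 ->
  exists f : T -> U, (forall x, A x -> B (f x)) /\
    (forall x y, A x -> A y -> f x = f y -> x = y).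
Proof.
move=> /card_leP[f] [b Bb].
have [g gAB ginj] : exists2 g : T -> U, set_fun A B g & set_inj A g.
  by apply/injfunPex; squash (valLR b f).
by exists g; split=> // x y Ax Ay; apply: ginj; exact: mem_set.
Qed.

Lemma card_le_set0 (T U : Type) (A : set T) (B : set U) :
  A #<= B -> A !=set0 -> B !=set0.
Proof.
move=> AB [a Aa]; apply/set0P/eqP => B0.
by move: AB; rewrite B0 card_le0 => /eqP A0; rewrite A0 in Aa.
Qed.

Lemma card_inl (T U : Type) (A : set T) : @inl T U @` A #= A.
Proof. by apply: inj_card_eq => x y _ _ []. Qed.

Lemma card_inr (T U : Type) (B : set U) : @inr T U @` B #= B.
Proof. by apply: inj_card_eq => x y _ _ []. Qed.

(** Well-foundedness gives comparability: one of the two sets has least cardinality. Both are first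
    copied into [T + U], since [card_le_min] compares sets in a single type. *)
Lemma card_le_total (T U : Type) (A : set T) (B : set U) : A #<= B \/ B #<= A.
Proof.
rewrite -(card_le_eql (card_inl U A)) -(card_le_eqr (card_inl U A)).
rewrite -(card_le_eql (card_inr T B)) -(card_le_eqr (card_inr T B)).
have [|D [->|->] Dmin] := @card_le_min (T + U)%type [set inl @` A; inr @` B].
- by exists (inl @` A); left.
- by left; apply: Dmin; right.
- by right; apply: Dmin; left.
Qed.

(** The universal property of a maximum, through which all later arguments use [card_max]. *)
Lemma card_max_le (T U V : Type) (A : set T) (B : set U) (C : set V) :
  card_max A B #<= C <-> A #<= C /\ B #<= C.
Proof.
rewrite /card_max; case: ifPn => [AB|nAB].
  rewrite (card_le_eql (card_inr T B)); split=> [BC|[]//].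
  by split=> //; exact: card_le_trans BC.
rewrite (card_le_eql (card_inl U A)); split=> [AC|[]//]; split=> //.
have [AB|BA] := card_le_total A B; first by rewrite AB in nAB.
exact: card_le_trans AC.
Qed.

Lemma card_leX (T T' U U' : Type) (A : set T) (A' : set T') (B : set U)
    (B' : set U') : A #<= A' -> B #<= B' -> A `*` B #<= A' `*` B'.
Proof.
have [->|/set0P A0] := eqVneq A set0; first by rewrite set0X card_ge0.
have [->|/set0P B0] := eqVneq B set0; first by rewrite setX0 card_ge0.
move=> AA' BB'.
have [f [fA finj]] := card_leE AA' (card_le_set0 AA' A0).
have [g [gB ginj]] := card_leE BB' (card_le_set0 BB' B0).
apply: (@card_leI _ _ _ _ (fun p => (f p.1, g p.2))) => [[x y] [Ax By]|].
  by split; [exact: fA|exact: gB].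
by move=> [x y] [x' y'] [/= ? ?] [/= ? ?] [/finj-> // /ginj->].
Qed.

(* Zorn on the graphs g of injections nat * B * B -> B with B included in A;
   the factor nat rules out finite nonempty B and absorbs finite unions. *)
Lemma infinite_card_setXX (T : Type) (A : set T) :
  infinite_set A -> A `*` A #<= A.
Proof.
move=> Ainf.
(* A point [x] of the base set is recognised by its triple [(0, x, x)] having a value. *)
pose dom (g : set (nat * T * T * T)) : set T :=
  [set x | exists z, g (0, x, x, z)].
pose N (B : set T) := [set: nat] `*` B `*` B.
pose P g := [/\ dom g `<=` A,
  forall p z, g (p, z) -> N (dom g) p /\ dom g z,
  forall p, N (dom g) p -> exists z, g (p, z),
  forall p z z', g (p, z) -> g (p, z') -> z = z' &
  forall p p' z, g (p, z) -> g (p', z) -> p = p'].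
have NS (B C : set T) : B `<=` C -> N B `<=` N C.
  by move=> BC [[n x] y] [[_ /BC Cx] /BC Cy].
have domS g g' : g `<=` g' -> dom g `<=` dom g'.
  by move=> gg' x [z /gg']; exists z.
have [|g [[gA gB gtot gfun ginj] gmax]] := @Zorn_bigcup _ P.
  move=> F FP Ftot.
  have Fjoin g g' : F g -> F g' -> exists h, [/\ F h, g `<=` h & g' `<=` h].
    move=> Fg Fg'; have [gg'|g'g] := Ftot _ _ Fg Fg'.
      by exists g'; split.
    by exists g; split.
  have FS g : F g -> g `<=` \bigcup_(X in F) X by move=> Fg x gx; exists g.
  split.
  - move=> x [z [g Fg gz]]; have [gA _ _ _ _] := FP _ Fg.
    by apply: gA; exists z.
  - move=> p z [g Fg gz]; have [_ gB _ _ _] := FP _ Fg.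
    have [Np dz] := gB _ _ gz.
    by split; [apply: NS Np; apply: domS (FS _ Fg)|exact: domS (FS _ Fg) _ dz].
  - move=> [[n x] y] [[_ [z [g Fg gz]]] [z' [g' Fg' gz']]].
    have [h [Fh gh g'h]] := Fjoin _ _ Fg Fg'.
    have [_ _ htot _ _] := FP _ Fh.
    have [|w hw] := htot (n, x, y); last by exists w; exists h.
    by split; [split=> //; exists z; exact: gh|exists z'; exact: g'h].
  - move=> p z z' [g Fg gz] [g' Fg' gz'].
    have [h [Fh gh g'h]] := Fjoin _ _ Fg Fg'.
    by have [_ _ _ hfun _] := FP _ Fh; exact: hfun (gh _ gz) (g'h _ gz').
  - move=> p p' z [g Fg gz] [g' Fg' gz'].
    have [h [Fh gh g'h]] := Fjoin _ _ Fg Fg'.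
    by have [_ _ _ _ hinj] := FP _ Fh; exact: hinj (gh _ gz) (g'h _ gz').
set B := dom g in gA gB gtot.
(* If all triples over the union of [B] and [C] injected into [C], sending the new triples there
   would properly extend [g], against maximality. *)
have noext (C : set T) : C !=set0 -> C `<=` A `\` B -> ~ (N (B `|` C) #<= C).
  move=> C0 CAB /card_leE/(_ C0)[h [hC hinj]].
  pose g' := g `|` [set q | [/\ N (B `|` C) q.1, ~ N B q.1 & q.2 = h q.1]].
  have dg' : dom g' = B `|` C.
    apply/seteqP; split=> [x [z [gz|[/= [[_ +] _]]]]|x BCx]//.
      by left; exists z.
    have [[z gz]|nBx] := pselect (B x); first by exists z; left.
    by exists (h (0, x, x)); right; split=> // -[].
  apply: (gmax g').
    split; first exact: subsetUl.
    move=> /domS; rewrite dg' => BCB; have [c Cc] := C0.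
    by have [_] := CAB _ Cc; apply; apply: BCB; right.
  split; rewrite ?dg'.
  - by move=> x [/gA//|/CAB[]].
  - move=> p z [/gB[Np Bz]|[/= Np _ ->]].
      by split; [apply: NS Np => x; left|left].
    by split=> //; right; exact: hC.
  - move=> p Np; have [/gtot[z gz]|nNp] := pselect (N B p).
      by exists z; left.
    by exists (h p); right.
  - move=> p z z' [gz|[/= _ nNp ->]] [gz'|[/= _ nNp' ->]]//.
    + exact: gfun gz gz'.
    + by have [] := gB _ _ gz.
    + by have [] := gB _ _ gz'.
  - move=> p p' z [gz|[/= Np nNp ->]] [gz'|[/= Np' nNp']]//.
    + exact: ginj gz gz'.
    + by move=> zh; have [_] := gB _ _ gz; have [_] := CAB _ (hC _ Np');
         rewrite zh.
    + by have [_] := gB _ _ gz'; have [_] := CAB _ (hC _ Np).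
    + exact: hinj.
have [a0 Aa0] := infinite_setN0 Ainf.
have NBB : N B #<= B.
  have /choice[f fP] : forall p, exists z, N B p -> g (p, z).
    move=> p; have [/gtot[z]|?] := pselect (N B p); first by exists z.
    by exists a0.
  apply: (@card_leI _ _ _ _ f) => [p /fP/gB[]//|p p' /fP gp /fP gp' fpp'].
  by apply: ginj gp _; rewrite fpp'.
have natBB : [set: nat] `*` B #<= B.
  apply: card_le_trans NBB.
  by apply: (@card_leI _ _ _ _ (fun p => (p, p.2))) => [[n x] []|? ? _ _ []].
have reduce : A #<= B -> A `*` A #<= A.
  move=> AB; apply: (card_le_trans (card_leX AB AB)).
  apply: (card_le_trans _ (subset_card_le gA)); apply: card_le_trans NBB.
  by apply: (@card_leI _ _ _ _ (fun p => (0, p.1, p.2)))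
    => [[x y] []|[x y] [x' y'] _ _ [-> ->]].
(* Points of [C] outside [B] go to a second copy of [B], with index 1; both copies fit into
   [nat * B]. *)
have cardBU (C : set T) : C #<= B -> B `|` C #<= B.
  have [->|/set0P C0] := eqVneq C set0.
    by rewrite setU0 => _; exact: card_lexx.
  move=> CB; have [f [fB finj]] := card_leE CB (card_le_set0 CB C0).
  apply: card_le_trans natBB.
  apply: (@card_leI _ _ _ _ (fun x => if `[< B x >] then (0, x) else (1, f x))).
    by move=> x; case: asboolP => [//|nBx [//|Cx]]; split=> //; exact: fB.
  move=> x y; case: asboolP => Bx; case: asboolP => By_ // BCx BCy [] //.
  by apply: finj; [case: BCx|case: BCy].
(* For empty [B], a countably infinite subset of [A] would already extend [g]. *)
have [B0|/set0P B0] := eqVneq B set0.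
  have /infiniteP/card_leE/(_ (ex_intro _ _ Aa0))[f [fA finj]] := Ainf.
  have fnat : range f #= [set: nat].
    by apply: inj_card_eq => m n _ _; exact: finj.
  exfalso; apply: (noext (range f)).
  - by exists (f 0), 0.
  - by move=> _ [n _ <-]; rewrite B0; split=> //; exact: fA.
  - have fn : range f #<= [set: nat] by exact: card_image_le.
    rewrite B0 set0U (card_le_eqr fnat).
    apply: (card_le_trans (card_leX (card_leX (card_lexx _) fn) fn)).
    exact: countableP.
(* Either the rest of [A] is absorbed by [B], which then has the size of [A], or it contains a copy
   of [B] over which [g] would extend. *)
have [DB|BD] := card_le_total (A `\` B) B.
  apply/reduce/card_le_trans/(cardBU _ DB); apply: subset_card_le => x Ax.
  by have [|] := pselect (B x); [left|right].
have [f [fAB finj]] := card_leE BD (card_le_set0 BD B0).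
have fB : f @` B #= B.
  by apply: inj_card_eq => x y /set_mem Bx /set_mem By_; exact: finj.
exfalso; apply: (noext (f @` B)).
- exact: image_nonempty.
- by move=> _ [x Bx <-]; exact: fAB.
- rewrite (card_le_eqr fB); apply: card_le_trans NBB.
  have BfB : B `|` f @` B #<= B by apply: cardBU; exact: card_image_le.
  exact: card_leX (card_leX (card_lexx _) BfB) BfB.
Qed.

Lemma infinite_card_setXn (T U V : Type) (A : set T) (B : set U) (K : set V) :
  infinite_set K -> A #<= K -> B #<= K -> A `*` B #<= K.
Proof.
move=> Kinf AK BK; apply: card_le_trans (infinite_card_setXX Kinf).
exact: card_leX.
Qed.

(** * Coding of finite sequences and trees in an infinite set *)

Lemma infinite_encoding (U : Type) (K : set U) : infinite_set K ->
  exists (j : nat -> U) (p : U -> U -> U),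
    [/\ forall n, K (j n), injective j, forall x y, K x -> K y -> K (p x y) &
    forall x y x' y', K x -> K y -> K x' -> K y' -> p x y = p x' y' ->
      x = x' /\ y = y'].
Proof.
move=> Kinf; have K0 := infinite_setN0 Kinf.
have [j [jK jinj]] := card_leE ((infiniteP _).1 Kinf) K0.
have [p [pK pinj]] := card_leE (infinite_card_setXX Kinf) K0.
exists j, (fun x y => p (x, y)); split.
- by move=> n; exact: jK.
- by move=> m n; exact: jinj.
- by move=> x y Kx Ky; exact: pK.
- move=> x y x' y' Kx Ky Kx' Ky'.
  by move=> /(pinj (x, y) (x', y') (conj Kx Ky) (conj Kx' Ky'))[].
Qed.

Lemma infinite_card_seq (T U : Type) (f : T -> U) (K : set U) :
  infinite_set K -> (forall x, K (f x)) -> injective f -> [set: seq T] #<= K.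
Proof.
move=> Kinf fK finj.
have [j [p [jK jinj pK pinj]]] := infinite_encoding Kinf.
pose enc := foldr (fun x => p (f x)) (j 0).
have encK s : K (enc s).
  by elim: s => [|x s IHs] /=; [exact: jK|exact: pK].
(* The length is recorded because the end marker [j 0] may also be a value of [p], so [enc] alone
   need not be injective. *)
apply: (@card_leI _ _ _ _ (fun s => p (j (size s)) (enc s))) => [s _|s t _ _].
  exact: pK.
move=> /pinj[]// /jinj; elim: s t => [|x s IHs] [|y t] //= [st].
by move=> /pinj[]// /finj -> /(IHs _ st) ->.
Qed.

(* The hull is the range of the evaluation of finite trees whose leaves are
   points of D0 and whose nodes are operations. *)
Lemma finitary_hull (X : eqType) (V : Type) (e : seq X -> nat -> X) (D0 : set X)
    (K : set V) : infinite_set K -> D0 #<= K ->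
  exists D, [/\ D0 `<=` D, D #<= K &
    forall s n, (forall x, x \in s -> D x) -> D (e s n)].
Proof.
move=> Kinf D0K; have [f [fK finj]] := card_leE D0K (infinite_setN0 Kinf).
have [j [p [jK jinj pK pinj]]] := infinite_encoding Kinf.
pose eval := fix eval (t : GenTree.tree (set_type D0)) : X :=
  match t with
  | GenTree.Leaf x => val x
  | GenTree.Node n ts => e (map eval ts) n
  end.
exists (range eval); split=> [x D0x||s n sD].
- by exists (GenTree.Leaf (SigSub (mem_set D0x))).
- apply: (card_le_trans (card_image_le _ _)).
  apply: (@card_le_trans _ _ _ [set: seq (nat + D0)]).
    apply: (@card_leI _ _ _ _ (@GenTree.encode D0)) => // t t' _ _.
    exact: (pcan_inj (@GenTree.codeK D0)).
  have Kd (d : D0) : K (f (val d)) by apply: fK; exact: set_valP.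
  (* The tags [j 0] and [j 1] keep node labels and leaves apart. *)
  pose h (x : nat + D0) :=
    match x with inl n => p (j 0) (j n) | inr d => p (j 1) (f (val d)) end.
  apply: (@infinite_card_seq _ _ h) => // [[n|d]|]; try exact: pK.
  move=> [m|d] [n|d'] /= /pinj[]; do ?[exact: jK|exact: Kd].
  + by move=> _ /jinj ->.
  + by move=> /jinj.
  + by move=> /jinj.
  + by move=> _ /(finj _ _ (set_valP d) (set_valP d'))/val_inj ->.
- have [ts <-] : exists ts, map eval ts = s.
    elim: s sD => [|x s IHs] sD; first by exists [::].
    have [t _ tx] := sD x (mem_head _ _).
    have [y ys|ts ts_s] := IHs; first by apply: sD; rewrite in_cons ys orbT.
    by exists (t :: ts); rewrite /= tx ts_s.
  by exists (GenTree.Node n ts).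
Qed.

Local Open Scope ring_scope.

(** * Additive form of almost isometric local retracts *)

Lemma finite_pos_lb (R : realType) (T : Type) (A : set T) (f : T -> R) :
  finite_set A -> (forall x, A x -> 0 < f x) ->
  exists2 m, 0 < m & forall x, A x -> m <= f x.
Proof.
move=> Afin f0; have /(@finite_seqP R)[s sE] := finite_image f Afin.
(* Starting the minimum at 1 keeps it positive and covers empty [A]. *)
exists (\big[Num.min/1]_(y <- s | 0 < y) y).
  by apply: lt_bigmin => //; exact: ltr01.
move=> x Ax; apply: (@ge_bigmin_seq _ _ _ _ _ (f x)); last exact: f0.
have : (f @` A) (f x) by exists x.
by rewrite sE.
Qed.

Lemma ailr_additiveP (R : realType) (X : metricType R) (Y : set X) :
  almost_isometric_local_retract Y <->
  forall (E : set X) (del : R), finite_set E -> 0 < del ->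
    exists T : X -> X,
      [/\ set_fun E Y T,
          forall x, (E `&` Y) x -> T x = x
        & forall x y, E x -> E y ->
            `|mdist (T x) (T y) - mdist x y| <= del].
Proof.
split=> HY E e Efin e0.
(* With [m * (1 + d) <= 1] for all distances [d] in [E], the relative error [e * m] costs at most
   [e] in absolute terms. *)
- have [m m0 mE] : exists2 m : R, 0 < m &
      forall z : X * X, (E `*` E) z -> m <= (1 + mdist z.1 z.2)^-1.
    apply: finite_pos_lb; first exact: finite_setX.
    by move=> z _; rewrite invr_gt0 ltr_pwDl// mdist_ge0.
  have em0 : 0 < e * m by exact: mulr_gt0.
  have [T [TY TE Td]] := HY E (e * m) Efin em0.
  exists T; split=> // x y Ex Ey; have /andP[] := Td _ _ Ex Ey.
  have /= := mE (x, y) (conj Ex Ey).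
  set d := mdist x y; set d' := mdist (T x) (T y).
  have d0 : 0 <= d by exact: mdist_ge0.
  have d'0 : 0 <= d' by exact: mdist_ge0.
  rewrite -[_^-1]mul1r ler_pdivlMr ?ltr_pwDl// => dm.
  have ed : e * m * d <= e by rewrite -mulrA ger_pMr//; lra.
  rewrite ler_pdivrMl ?addr_gt0// ler_norml => dd' d'd.
  apply/andP; split; last lra.
  (* If [d' < d], then [d - d' <= e * m * d'], which is below [e * m * d]. *)
  have [|d'd1] := lerP d d'; first lra.
  have : e * m * d' <= e * m * d by rewrite ler_pM2l// ltW.
  lra.
- have [m m0 mE] : exists2 m : R, 0 < m & forall z : X * X,
      ((E `*` E) `\` [set z | z.1 = z.2]) z -> m <= mdist z.1 z.2.
    apply: finite_pos_lb; first by apply: finite_setD; exact: finite_setX.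
    by move=> [x y] [_ /eqP xy]; rewrite mdist_gt0.
  (* Chosen so that [d - del >= d / (1 + e)] whenever [d >= m]; the upper bound follows from
     [e / (1 + e) <= e]. *)
  pose del := m * (e / (1 + e)).
  have e1 : 0 < 1 + e by rewrite addr_gt0.
  have q0 : 0 < e / (1 + e) by rewrite divr_gt0.
  have del0 : 0 < del by rewrite mulr_gt0.
  have [T [TY TE Td]] := HY E del Efin del0.
  exists T; split=> // x y Ex Ey; have := Td _ _ Ex Ey.
  have [->|/eqP xy] := eqVneq x y; first by rewrite !mdistxx !mulr0 lexx.
  have /= := mE (x, y) (conj (conj Ex Ey) xy).
  set d := mdist x y; set d' := mdist (T x) (T y) => md.
  have d0 : 0 <= d by exact: mdist_ge0.
  have q1 : e / (1 + e) = 1 - (1 + e)^-1 by field; rewrite gt_eqF.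
  have deld : del <= d * (e / (1 + e)) by rewrite ler_pM2r.
  have deld' : d * (e / (1 + e)) <= d * e.
    by rewrite ler_wpM2l// ler_pdivrMr//; nra.
  rewrite ler_norml => /andP[]; move: deld deld'; rewrite q1.
  by move=> *; apply/andP; split; lra.
Qed.

(** * Closures of up-directed unions and small hulls *)

Lemma up_directed_finite (T : eqType) (A : set (set T)) (E : set T) :
  up_directed A -> finite_set E -> E `<=` \bigcup_(B in A) B ->
  exists2 B, A B & E `<=` B.
Proof.
move=> [[B0 AB0] dirA] /finite_seqP[s ->]; elim: s => [_|x s IHs sA].
  by exists B0.
have [B AB sB] : exists2 B, A B & [set` s] `<=` B.
  by apply: IHs => y ys; apply: sA; rewrite /= in_cons ys orbT.
have [C AC Cx] := sA x (mem_head _ _).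
have [D AD BCD] := dirA _ _ AB AC; exists D => // y /=.
by rewrite in_cons => /predU1P[->|/sB By]; apply: BCD; [right|left].
Qed.

Lemma mdist_quad (R : realType) (X : metricType R) (x y x' y' : X) :
  `|mdist x y - mdist x' y'| <= mdist x x' + mdist y y'.
Proof.
have := (metric_triangle x x' y, metric_triangle x' y' y).
have := (metric_triangle x' x y', metric_triangle x y y').
rewrite [mdist x' x]metric_sym [mdist y' y]metric_sym ler_norml.
by move=> -[? ?] [? ?]; apply/andP; split; lra.
Qed.

Lemma ailr_closure_bigcup (R : realType) (X : metricType R)
    (A : set (set X)) : up_directed A ->
  (forall B, A B -> almost_isometric_local_retract B) ->
  almost_isometric_local_retract (closure (\bigcup_(B in A) B)).
Proof.
move=> dirA Aailr; apply/ailr_additiveP => E del Efin del0.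
set F := closure _.
have /choice[phi phiP] : forall x, exists x', F x ->
    (* Five errors of this size will add up: one from [T], and for each of two points one from [psi]
       and one from replacing [T (psi x)] by [T' x]. *)
    (\bigcup_(B in A) B) x' /\ mdist x x' < del / 5.
  move=> x; have [Fx|nFx] := pselect (F x); last by exists x.
  have [|x' [Ux' xx']] := Fx (ball x (del / 5)).
    by apply: nbhsx_ballx; rewrite divr_gt0.
  by exists x' => _; split=> //; move: xx'; rewrite ballEmdist.
have [B AB EB] : exists2 B, A B & phi @` (E `&` F) `<=` B.
  apply: up_directed_finite => //.
    by apply: finite_image; exact: finite_setIl.
  by move=> _ [x [_ /phiP[]] + _ <-].
pose psi x := if `[< F x >] then phi x else x.
have psid x : mdist x (psi x) <= del / 5.
  rewrite /psi; case: asboolP => [/phiP[_ /ltW//]|_].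
  by rewrite mdistxx divr_ge0// ltW.
have [|T [TB TE Td]] :=
    (ailr_additiveP B).1 (Aailr _ AB) _ (del / 5) (finite_image psi Efin).
  by rewrite divr_gt0.
(* Points of [F] must be fixed exactly; there [T] fixes [psi x], so undoing the move costs only the
   distance from [x] to [psi x]. *)
pose T' x := if `[< F x >] then x else T x.
have T'd x : E x -> mdist (T' x) (T (psi x)) <= del / 5.
  move=> Ex; rewrite /T' /psi; case: asboolP => [Fx|_].
    have psix : psi x = phi x by rewrite /psi asboolT.
    rewrite TE; first by have [_ /ltW] := phiP _ Fx.
    by split; [exists x|apply: EB; exists x].
  by rewrite mdistxx divr_ge0// ltW.
exists T'; split.
- move=> x Ex; rewrite /T'; case: asboolP => [//|nFx].
  apply: subset_closure; exists B => //; apply: TB; exists x => //.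
  by rewrite /psi asboolF.
- by move=> x [_ Fx]; rewrite /T' asboolT.
- move=> x y Ex Ey.
  have := Td _ _ (ex_intro2 _ _ x Ex erefl) (ex_intro2 _ _ y Ey erefl).
  have := mdist_quad (T' x) (T' y) (T (psi x)) (T (psi y)).
  have := mdist_quad (psi x) (psi y) x y.
  move: (T'd _ Ex) (T'd _ Ey) (psid x) (psid y).
  rewrite [mdist x (psi x)]metric_sym [mdist y (psi y)]metric_sym !ler_norml.
  move=> ? ? ? ? /andP[? ?] /andP[? ?] /andP[? ?].
  by apply/andP; split; lra.
Qed.

(* The points of a finite configuration outside D are replaced by witnesses
   taken from D with the same distances up to rounding; as rounded distance
   matrices form a countable type, countably many finitary operations suffice
   to provide all witnesses. *)
Lemma ailr_hull (R : realType) (X : metricType R) (V : Type) (x0 : X)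
    (D0 : set X) (K : set V) : infinite_set K -> (D0 #<= K)%card ->
  exists D, [/\ D0 `<=` D, (D #<= K)%card & almost_isometric_local_retract D].
Proof.
move=> Kinf D0K.
pose key (n : nat) (w : seq X) :=
  [seq [seq Num.floor (n%:R * mdist x y) | y <- w] | x <- w].
have nth_key n w i j : (i < size w)%N -> (j < size w)%N ->
    nth 0 (nth [::] (key n w) i) j =
    Num.floor (n%:R * mdist (nth x0 w i) (nth x0 w j)).
  by move=> iw jw; rewrite (nth_map x0)// (nth_map x0).
pose wit (a : seq X) (c : nat * seq (seq int)) : seq X :=
  xget [::] [set b | key c.1 (a ++ b) = c.2].
(* The index [k] codes a rounding scale, a rounded distance matrix and a position in the witness
   list; [x0] is the value at codes that do not decode. *)
pose op (a : seq X) (k : nat) : X :=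
  if @unpickle (nat * seq (seq int) * nat)%type k is Some (c, j)
  then nth x0 (wit a c) j else x0.
have [D [D0D DK opD]] := finitary_hull op Kinf D0K.
exists D; split=> //; apply/ailr_additiveP => E del Efin del0.
have /finite_seqP[a aE] := finite_setIl D Efin.
have /finite_seqP[b bE] := finite_setD D Efin.
pose n := (Num.truncn del^-1).+1.
have n0 : 0 < n%:R :> R by rewrite ltr0n.
have ndel : n%:R^-1 < del.
  by rewrite -[ltRHS]invrK ltf_pV2 ?posrE ?invr_gt0// truncnS_gt.
pose b' := wit a (n, key n (a ++ b)).
(* The list [b] realises its own matrix, so [wit] returns a true witness and not its default. *)
have keyE : key n (a ++ b') = key n (a ++ b).
  exact: (@xgetPex _ [::] [set b' | key n (a ++ b') = key n (a ++ b)]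
    (ex_intro _ b erefl)).
have szE : size (a ++ b') = size (a ++ b).
  by have := congr1 size keyE; rewrite !size_map.
have abE x : E x -> x \in a ++ b.
  move=> Ex; rewrite mem_cat; have [Dx|nDx] := pselect (D x).
    by have : (E `&` D) x by []; rewrite aE /= => ->.
  by have : (E `\` D) x by []; rewrite bE /= => ->; rewrite orbT.
have aD x : x \in a -> D x.
  by move=> xa; have : [set` a] x by []; rewrite -aE => -[].
(* Entries of [a ++ b] go to the entries of [a ++ b'] at the same positions, so points of [a] stay
   fixed. *)
pose T x := nth x0 (a ++ b') (index x (a ++ b)).
have TDE x : (E `&` D) x -> T x = x.
  rewrite aE /= => xa.
  by rewrite /T index_cat xa nth_cat index_mem xa nth_index.
exists T; split=> [x Ex||x y Ex Ey].
- have [Dx|nDx] := pselect (D x); first by rewrite TDE.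
  have xa : x \in a = false by apply/negP => /aD.
  rewrite /T index_cat xa nth_cat ltnNge leq_addr/= addKn.
  have <- : op a (pickle (n, key n (a ++ b), index x b)) =
      nth x0 b' (index x b).
    by rewrite /op pickleK.
  exact: opD.
- by [].
- have ix : (index x (a ++ b) < size (a ++ b))%N by rewrite index_mem abE.
  have iy : (index y (a ++ b) < size (a ++ b))%N by rewrite index_mem abE.
  (* Equal floors leave a difference below 1 after scaling by [n], hence below [1 / n < del]. *)
  have : Num.floor (n%:R * mdist (T x) (T y)) = Num.floor (n%:R * mdist x y).
    by rewrite -nth_key ?szE// keyE nth_key// !nth_index// abE.
  set d := mdist (T x) (T y); set d' := mdist x y => fdd'.
  have := (floor_itv (n%:R * d), floor_itv (n%:R * d')).
  rewrite fdd' intrD => -[/andP[? ?] /andP[? ?]].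
  apply: le_trans (ltW ndel); rewrite -[leRHS]mul1r ler_pdivlMr//.
  rewrite -[X in _ * X]gtr0_norm// -normrM ler_norml.
  by apply/andP; split; lra.
Qed.

(** * Density of closures and of subspaces *)

Lemma dens_closure_le (Z : topologicalType) (V : Type) (D : set Z)
    (K : set V) :
  (D #<= K)%card -> (dens (set_type (closure D)) #<= K)%card.
Proof.
move=> DK; have [_ densmin] := dens_spec (set_type (closure D)).
apply: card_le_trans DK; apply: (card_le_trans (densmin (val @^-1` D) _)).
  move=> O [z Oz] [W Wopen WO].
  have Dz : closure D (val z) by exact: set_valP.
  have [|d [Dd Wd]] := Dz W.
    by apply: open_nbhs_nbhs; split=> //; rewrite -WO in Oz.
  have cDd : closure D d by exact: subset_closure.
  by exists (SigSub (mem_set cDd)); split=> //; rewrite -WO.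
apply: (@card_leI _ _ _ _ val) => // x y _ _; exact: val_inj.
Qed.

(** For each [n] and each point of a dense subset of [F], choose a point of [Y] within [1 / (n + 1)]
    of it if there is one. The chosen points are dense in [Y], and their number is absorbed by the
    infinite [K]. *)
Lemma dens_subset_le (R : realType) (X : metricType R) (V : Type)
    (Y F : set X) (K : set V) : infinite_set K -> Y `<=` F ->
  (dens (set_type F) #<= K)%card -> (dens (set_type Y) #<= K)%card.
Proof.
move=> Kinf YF FK; have [_ densmin] := dens_spec (set_type Y).
have [dF _] := dens_spec (set_type F).
have [[y0 _]|Y0] := pselect ([set: set_type Y] !=set0); last first.
  rewrite (_ : dens _ = set0) ?card_ge0//.
  by apply/seteqP; split=> // y _; case: Y0; exists y.
have /choice[f fP] : forall p : nat * set_type F, exists y : set_type Y,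
    forall y' : set_type Y, mdist (val p.2) (val y') < p.1.+1%:R^-1 ->
      mdist (val p.2) (val y) < p.1.+1%:R^-1.
  move=> p; have [[y py]|np] := pselect (exists y : set_type Y,
      mdist (val p.2) (val y) < p.1.+1%:R^-1).
    by exists y.
  by exists y0 => y py; case: np; exists y.
have natK : ([set: nat] #<= K)%card by exact/infiniteP.
apply: card_le_trans (infinite_card_setXn Kinf natK FK).
apply: card_le_trans (card_image_le f _); apply: densmin.
move=> O [y Oy] [W Wopen WO].
have /nbhs_ballP[r /= r0 rW] : nbhs (val y) W.
  by apply: open_nbhs_nbhs; split=> //; rewrite -WO in Oy.
pose n := Num.truncn (r / 2)^-1.
have nr : n.+1%:R^-1 < r / 2.
  by rewrite -[ltRHS]invrK ltf_pV2 ?posrE ?invr_gt0 ?divr_gt0 ?truncnS_gt.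
have Fy : F (val y) by apply: YF; exact: set_valP.
have [||d [yd dd]] := dF (val @^-1` (ball (val y) n.+1%:R^-1)^°).
- exists (SigSub (mem_set Fy)); apply: nbhsx_ballx.
  by rewrite invr_gt0.
- by exists (ball (val y) n.+1%:R^-1)^° => //; exact: open_interior.
exists (f (n, d)); split; last by exists (n, d).
rewrite -WO; apply: rW; rewrite ballEmdist /=.
have {}yd := interior_subset yd; rewrite ballEmdist /= in yd.
have fd : mdist (val d) (val (f (n, d))) < n.+1%:R^-1.
  by apply: (fP (n, d) y); rewrite metric_sym.
rewrite [ltRHS]splitr; apply: (le_lt_trans (metric_triangle _ (val d) _)).
by apply: ltrD; apply: lt_trans nr.
Qed.

(** * The exceedingly rich family *)

Theorem theorem2 (R : realType) (X : metricType R) :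
  exists S : set (set X),
    exceedingly_rich S /\
    (forall F : set X, S F -> almost_isometric_local_retract F).
Proof.
exists [set F | closed F /\ almost_isometric_local_retract F].
split; last by move=> F [].
split; first by move=> F [].
(* The whole space is a retract by the identity. Any other [Y] misses a point, which serves as the
   default [x0] of the hull; this also settles empty [X]. *)
- move=> Y; have [->|] := eqVneq Y setT.
    exists setT; split=> //.
    split; first exact: closedT.
    move=> E eps _ eps0; exists id; split=> // x y _ _.
    have e1 : 0 < 1 + eps by rewrite addr_gt0.
    have := mdist_ge0 x y; set d := mdist x y => d0.
    apply/andP; split; last nra.
    by rewrite ler_pdivrMl//; nra.
  move=> /eqP YT; have [x0 _] : (~` Y) !=set0.
    by apply/set0P/eqP => /(congr1 setC); rewrite setCK setC0.
  set K := card_max (dens (set_type Y)) [set: nat].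
  have [YK natK] : (dens (set_type Y) #<= K)%card /\ ([set: nat] #<= K)%card.
    by apply/card_max_le; exact: card_lexx.
  have Kinf : infinite_set K by exact/infiniteP.
  have [|D [YD DK Dailr]] :=
      @ailr_hull _ _ _ x0 (val @` dens (set_type Y)) _ Kinf.
    exact: card_le_trans (card_image_le _ _) YK.
  have YF : Y `<=` closure D.
    move=> y Yy U Uy.
    have [||d [Ud dd]] := (dens_spec (set_type Y)).1 (val @^-1` U^°).
    + by exists (SigSub (mem_set Yy)).
    + by exists U^° => //; exact: open_interior.
    + exists (val d); split; last exact: interior_subset.
      by apply: YD; exists d.
  exists (closure D); split=> //.
    split; first exact: closed_closure.
    (* The one-member family of [D] is up-directed, so the result on unions covers the closure of a
       single retract. *)
    rewrite -(bigcup_set1 id D); apply: ailr_closure_bigcup => [|_ ->//].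
    by split; [exists D|move=> B C -> ->; exists D => //; rewrite setUid].
  rewrite card_eq_le; apply/andP; split; apply/card_max_le; split.
  + set K' := card_max (dens (set_type (closure D))) [set: nat].
    have [FK' natK'] := (card_max_le _ _ K').1 (card_lexx K').
    by apply: dens_subset_le YF FK'; exact/infiniteP.
  + have [] := (card_max_le (dens (set_type (closure D))) [set: nat] _).1
      (card_lexx _).
    by [].
  + exact: dens_closure_le.
  + by [].
- move=> A AS dirA; split; first exact: closed_closure.
  by apply: ailr_closure_bigcup => // B /AS[].
Qed.
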